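(* Let $\mathbf{k}$ be a field of characteristic zero and $\lambda\in\mathbf{k}$ nonzero. Let $R$ be a modified Rota-Baxter operator of weight $\lambda$ on a pre-Lie algebra $(\mathfrak{g},\ast)$ over $\mathbf{k}$, and let $f\in\mathfrak{g}^*$ satisfy $f(x\ast y-y\ast x)=0$ for all $x,y\in\mathfrak{g}$. Define $$[x,y,z]_f=f(x)(y\ast z-z\ast y)+f(y)(z\ast x-x\ast z)+f(z)(x\ast y-y\ast x),\qquad x,y,z\in\mathfrak{g}.$$ Then $R$ is a modified Rota-Baxter operator of weight $\lambda$ on the $3$-Lie algebra $(\mathfrak{g},[\cdot,\cdot,\cdot]_f)$ if and only if for all $x,y,z\in\mathfrak{g}$ \begin{align*} &R\Big(f(x)(Ry\ast Rz-Rz\ast Ry)+f(y)(Rz\ast Rx-Rx\ast Rz)+f(z)(Rx\ast Ry-Ry\ast Rx)\\ &\quad+\lambda f(x)(y\ast z-z\ast y)+\lambda f(y)(z\ast x-x\ast z)+\lambda f(z)(x\ast y-y\ast x)\Big)\\ &-\lambda f(x)(Ry\ast z-z\ast Ry)-\lambda f(x)(y\ast Rz-Rz\ast y)-\lambda f(y)(Rz\ast x-x\ast Rz)\\ &-\lambda f(y)(z\ast Rx-Rx\ast z)-\lambda f(z)(Rx\ast y-y\ast Rx)-\lambda f(z)(x\ast Ry-Ry\ast x)\\ &-2\lambda f(Ry)(z\ast x-x\ast z)-2\lambda f(Rx)(y\ast z-z\ast y)-2\lambda f(Rz)(x\ast y-y\ast x)=0. \end{align*}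
   Context: A pre-Lie algebra is a vector space with a bilinear product $\ast$ whose associator $(x\ast y)\ast z-x\ast(y\ast z)$ is symmetric in $x,y$ (left convention) or symmetric in $y,z$ (right convention); either convention is allowed here, and in both cases $x\ast y-y\ast x$ is a Lie bracket. A modified Rota-Baxter operator of weight $\lambda$ on $(\mathfrak{g},\ast)$ is a linear map $R:\mathfrak{g}\to\mathfrak{g}$ with $Rx\ast Ry=R(Rx\ast y+x\ast Ry)+\lambda\,x\ast y$ for all $x,y$. A $3$-Lie algebra is a vector space with a skew-symmetric trilinear bracket satisfying $[x,y,[u,v,w]]=[[x,y,u],v,w]+[u,[x,y,v],w]+[u,v,[x,y,w]]$. It is known that $[\cdot,\cdot,\cdot]_f$ is a $3$-Lie bracket under the hypothesis on $f$. A modified Rota-Baxter operator of weight $\lambda$ on a $3$-Lie algebra $(\mathfrak{g},[\cdot,\cdot,\cdot])$ is a linear map $R:\mathfrak{g}\to\mathfrak{g}$ such that for all $x,y,z$ $$[Rx,Ry,Rz]=R\big([Rx,Ry,z]+[x,Ry,Rz]+[Rx,y,Rz]+\lambda[x,y,z]\big)-\lambda[Rx,y,z]-\lambda[x,Ry,z]-\lambda[x,y,Rz].$$ *)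

(* Defs.v *)
From HB Require Import structures.
From mathcomp Require Import all_boot all_order all_algebra.
Set Implicit Arguments.
Unset Strict Implicit.
Unset Printing Implicit Defensive.
Import GRing.Theory.
Local Open Scope ring_scope.

Section PreLie.
Variables (k : fieldType) (g : lmodType k).

Definition associator (mul : g -> g -> g) (x y z : g) : g :=
  mul (mul x y) z - mul x (mul y z).

Definition left_pre_lie (mul : g -> g -> g) : Prop :=
  forall x y z, associator mul x y z = associator mul y x z.

Definition right_pre_lie (mul : g -> g -> g) : Prop :=
  forall x y z, associator mul x y z = associator mul x z y.

Record preLieAlgebra := PreLieAlgebra {
  pre_lie_mul :> {bilinear g -> g -> g};
  pre_lieP : left_pre_lie pre_lie_mul \/ right_pre_lie pre_lie_mul
}.

End PreLie.

Notation "x *_[ A ] y" := (pre_lie_mul A x y)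
  (at level 40, left associativity, format "x  *_[ A ]  y") : ring_scope.

Definition modified_RB_preLie (k : fieldType) (g : lmodType k)
    (A : preLieAlgebra g) (lambda : k) (R : {linear g -> g}) : Prop :=
  forall x y : g,
    R x *_[A] R y = R (R x *_[A] y + x *_[A] R y) + lambda *: (x *_[A] y).

Section ThreeLie.
Variables (k : fieldType) (g : lmodType k).

Definition trilinear (br : g -> g -> g -> g) : Prop :=
  [/\ forall y z, linear (fun x => br x y z),
      forall x z, linear (fun y => br x y z)
    & forall x y, linear (fun z => br x y z)].

(* The two adjacent transpositions generate the symmetric group on the three
   arguments. *)
Definition skew_symmetric3 (br : g -> g -> g -> g) : Prop :=
  forall x y z, br y x z = - br x y z /\ br x z y = - br x y z.

Definition fundamental_identity (br : g -> g -> g -> g) : Prop :=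
  forall x y u v w,
    br x y (br u v w) =
      br (br x y u) v w + br u (br x y v) w + br u v (br x y w).

Record threeLieAlgebra := ThreeLieAlgebra {
  three_lie_br :> g -> g -> g -> g;
  three_lie_linear : trilinear three_lie_br;
  three_lie_skew : skew_symmetric3 three_lie_br;
  three_lie_fundamental : fundamental_identity three_lie_br
}.

Definition modified_RB_threeLie (L : threeLieAlgebra) (lambda : k)
    (R : {linear g -> g}) : Prop :=
  forall x y z : g,
    L (R x) (R y) (R z) =
      R (L (R x) (R y) z + L x (R y) (R z) + L (R x) y (R z)
         + lambda *: L x y z)
      - lambda *: L (R x) y z - lambda *: L x (R y) z - lambda *: L x y (R z).

End ThreeLie.

Section BracketF.
Variables (k : fieldType) (g : lmodType k).
Variables (A : preLieAlgebra g) (f : {scalar g}).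

Definition bracketf (x y z : g) : g :=
  f x *: (y *_[A] z - z *_[A] y) + f y *: (z *_[A] x - x *_[A] z)
  + f z *: (x *_[A] y - y *_[A] x).

Hypothesis f_comm : forall x y : g, f (x *_[A] y - y *_[A] x) = 0.

(* Locked so that rewriting does not see the difference underneath. *)
Let lb (x y : g) : g := locked (x *_[A] y - y *_[A] x).

Let lbDl x y z : lb (x + y) z = lb x z + lb y z.
Proof. by rewrite /lb -!lock linearDl linearDr opprD addrACA. Qed.

Let lbC x y : lb y x = - lb x y.
Proof. by rewrite /lb -!lock opprB. Qed.

Let lbDr x y z : lb z (x + y) = lb z x + lb z y.
Proof. by rewrite lbC lbDl opprD -!lbC. Qed.

Let lbZl a x z : lb (a *: x) z = a *: lb x z.
Proof. by rewrite /lb -!lock linearZl_LR linearZr_LR scalerBr. Qed.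

Let lbZr a x z : lb z (a *: x) = a *: lb z x.
Proof. by rewrite lbC lbZl -scalerN -lbC. Qed.

Let lbNr x z : lb z (- x) = - lb z x.
Proof. by rewrite -scaleN1r lbZr scaleN1r. Qed.

Let lbBr x y z : lb z (x - y) = lb z x - lb z y.
Proof. by rewrite lbDr lbNr. Qed.

Let lbNl x z : lb (- x) z = - lb x z.
Proof. by rewrite -scaleN1r lbZl scaleN1r. Qed.

Ltac cancel_sum :=
  rewrite ?opprD ?opprK -?addrA;
  repeat first
    [ done
    | match goal with
      | |- - ?a + ?r = 0 => rewrite ?(addrCA _ a) addNKr
      | |- ?a + ?r = 0 => rewrite ?(addrCA _ (- a)) addKr
      end ].

Let jacobi x y z : lb x (lb y z) = lb (lb x y) z + lb y (lb x z).
Proof.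
apply/eqP; rewrite -subr_eq0 -[X in X == _]addr0; apply/eqP.
have E u v w : lb u (lb v w) =
    u *_[A] (v *_[A] w) - u *_[A] (w *_[A] v)
    - ((v *_[A] w) *_[A] u - (w *_[A] v) *_[A] u).
  by rewrite /lb -!lock linearBl linearBr.
rewrite (lbC z (lb x y)) !E.
case: (pre_lieP A) => H.
- have K u v w : (u *_[A] v) *_[A] w =
    (v *_[A] u) *_[A] w - v *_[A] (u *_[A] w) + u *_[A] (v *_[A] w).
    by apply/eqP; rewrite -subr_eq; apply/eqP; exact: H.
  rewrite (K x y z) (K x z y) (K y z x).
  by cancel_sum.
- have K u v w : (u *_[A] v) *_[A] w =
    (u *_[A] w) *_[A] v - u *_[A] (w *_[A] v) + u *_[A] (v *_[A] w).
    by apply/eqP; rewrite -subr_eq; apply/eqP; exact: H.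
  rewrite (K x y z) (K y x z) (K z x y).
  by cancel_sum.
Qed.

Let brE x y z : bracketf x y z = f x *: lb y z + f y *: lb z x + f z *: lb x y.
Proof. by rewrite /lb -!lock. Qed.

Lemma bracketf_skew : skew_symmetric3 bracketf.
Proof.
move=> x y z; rewrite !brE; split.
  by rewrite (lbC z x) (lbC y z) (lbC x y) !scalerN !opprD; congr (_ + _); exact: addrC.
by rewrite (lbC y z) (lbC x y) (lbC z x) !scalerN !opprD addrAC.
Qed.

Let linear3 x y : linear (fun z => bracketf x y z).
Proof.
move=> a u v; rewrite !brE lbDr lbDl lbZl lbZr linearP /= scalerDl !scalerDr.
rewrite !scalerA (mulrC a (f x)) (mulrC a (f y)).
by rewrite [RHS]addrACA; congr (_ + _); exact: addrACA.
Qed.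

Lemma bracketf_trilinear : trilinear bracketf.
Proof.
split=> [y z|x z|x y] a u v; last exact: linear3.
  have rot t : bracketf t y z = bracketf y z t.
    by rewrite !brE -addrA addrC.
  by rewrite !rot linear3.
have neg t : bracketf x t z = - bracketf x z t.
  by case: (bracketf_skew x z t).
by rewrite !neg linear3 opprD scalerN.
Qed.

Let f_lb x y : f (lb x y) = 0. Proof. by rewrite /lb -lock f_comm. Qed.

Let f_br x y z : f (bracketf x y z) = 0.
Proof.
by rewrite brE linearD linearD !linearZ /= !f_lb !mulr0 !addr0.
Qed.

Lemma bracketf_fundamental : fundamental_identity bracketf.
Proof.
move=> x y u v w.
pose D t := f x *: lb y t - f y *: lb x t.
have DD s t : D (s + t) = D s + D t.
  by rewrite /D !lbDr !scalerDr opprD addrACA.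
have DZ a t : D (a *: t) = a *: D t.
  by rewrite /D !lbZr scalerBr !scalerA !(mulrC a).
have Dlb s t : D (lb s t) = lb (D s) t + lb s (D t).
  rewrite /D (jacobi y) (jacobi x) !lbDl !lbNl !lbBr !lbZl !lbZr.
  by rewrite !scalerDr opprD addrACA.
have brD t : bracketf x y t = D t + f t *: lb x y.
  by rewrite brE /D (lbC x t) scalerN.
rewrite [LHS]brD f_br scale0r addr0.
rewrite [in RHS](brE (bracketf x y u)) [in RHS](brE u (bracketf x y v)).
rewrite [in RHS](brE u v (bracketf x y w)) !f_br !scale0r add0r !addr0.
rewrite brE !DD !DZ !Dlb !brD !lbDl !lbDr !lbZl !lbZr.
set c := lb x y.
rewrite (lbC w c) (lbC u c) (lbC v c) !scalerDr !scalerN !scalerA.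
rewrite (mulrC (f w) (f v)) (mulrC (f v) (f u)) (mulrC (f w) (f u)).
apply/eqP; rewrite -subr_eq0 -[X in X == _]addr0; apply/eqP.
by cancel_sum.
Qed.

Definition bracketf_threeLie : threeLieAlgebra g :=
  ThreeLieAlgebra bracketf_trilinear bracketf_skew bracketf_fundamental.

End BracketF.

(* Main.v *)
(** The commutator of a pre-Lie product inherits the modified Rota-Baxter
    identity.  Applying it to the three commutators of images under R in
    [Rx, Ry, Rz]_f turns the expression of the theorem into the difference of
    the two sides of the 3-Lie identity; the terms -2 lambda f(Rx) [y, z]
    combine one contribution from each side. *)
Require Import Defs.
From HB Require Import structures.
From mathcomp Require Import all_boot all_order all_algebra.
Import GRing.Theory.
Local Open Scope ring_scope.

Definition lie_bracket {k : fieldType} {g : lmodType k} (A : preLieAlgebra g)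
  (x y : g) : g := x *_[A] y - y *_[A] x.

Section ModifiedRotaBaxter.
Variables (k : fieldType) (g : lmodType k) (A : preLieAlgebra g).
Variables (lambda : k) (R : {linear g -> g}).
Hypothesis RB_R : modified_RB_preLie A lambda R.

Local Notation "[ x , y ]" := (lie_bracket A x y).

(** Subtract the identity at [(y, x)] from that at [(x, y)]: the four products under [R] regroup
    into two commutators. *)
Lemma modified_RB_lie_bracket (x y : g) :
  [R x, R y] = R ([R x, y] + [x, R y]) + lambda *: [x, y].
Proof.
rewrite /lie_bracket !RB_R opprD addrACA -linearB scalerBr.
by congr (R _ + _); rewrite opprD [- _ - _]addrC addrACA.
Qed.

(** The terms [f (R x) *: R ([R y, z] + [y, R z])] and their cyclic analogues cancel against the
    expansion of [L (R x) (R y) (R z)]. The leftover [- (lambda * f (R x)) *: [y, z]] doubles the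
    same term of [- lambda *: L (R x) y z]. *)
Lemma bracketf_RB_defect (f : {scalar g}) (x y z : g)
    (L := bracketf A f) :
  R (f x *: [R y, R z] + f y *: [R z, R x] + f z *: [R x, R y]
     + (lambda * f x) *: [y, z] + (lambda * f y) *: [z, x]
     + (lambda * f z) *: [x, y])
  - (lambda * f x) *: [R y, z] - (lambda * f x) *: [y, R z]
  - (lambda * f y) *: [R z, x] - (lambda * f y) *: [z, R x]
  - (lambda * f z) *: [R x, y] - (lambda * f z) *: [x, R y]
  - (2%:R * lambda * f (R y)) *: [z, x]
  - (2%:R * lambda * f (R x)) *: [y, z]
  - (2%:R * lambda * f (R z)) *: [x, y] =
  R (L (R x) (R y) z + L x (R y) (R z) + L (R x) y (R z)
     + lambda *: L x y z)
  - lambda *: L (R x) y z - lambda *: L x (R y) z - lambda *: L x y (R z)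
  - L (R x) (R y) (R z).
Proof.
have LE u v w : L u v w = f u *: [v, w] + f v *: [w, u] + f w *: [u, v].
  by [].
have RBE u v : [R u, R v] = R [R u, v] + R [u, R v] + lambda *: [u, v].
  by rewrite modified_RB_lie_bracket linearD.
(* Only this term is expanded by [RBE]: [f x *: [R y, R z]] and its cyclic analogues occur under [R]
   on both sides and cancel as they stand. *)
have LRE : L (R x) (R y) (R z)
    = f (R x) *: (R [R y, z] + R [y, R z] + lambda *: [y, z])
      + f (R y) *: (R [R z, x] + R [z, R x] + lambda *: [z, x])
      + f (R z) *: (R [R x, y] + R [x, R y] + lambda *: [x, y]).
  by rewrite LE !RBE.
rewrite {}LRE !LE; clear L LE RBE; move: (lie_bracket A) => br.
rewrite !(linearD, linearZ) /= !scalerDr !scalerA.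
rewrite -!mulrA !mulr_natl !mulr2n !scalerDl !(mulrC (f (R _)) lambda).
(* The trailing 0 gives every term a right neighbour, so that the loop below can bring the opposite
   of the leading term to the front and cancel the pair, down to the last one. *)
apply/eqP; rewrite -subr_eq0 -[X in X == _]addr0; apply/eqP.
rewrite ?scalerN ?opprD ?opprK -!addrA.
by repeat match goal with
  | |- - ?a + _ = 0 => rewrite ?(addrCA _ a) addNKr
  | |- ?a + _ = 0 => rewrite ?(addrCA _ (- a)) addKr
  end.
Qed.

End ModifiedRotaBaxter.

Theorem theorem4p8 (k : fieldType) (char0 : [pchar k] =i pred0)
    (lambda : k) (lambda_neq0 : lambda != 0)
    (g : lmodType k) (A : preLieAlgebra g)
    (R : {linear g -> g}) (RB_R : modified_RB_preLie A lambda R)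
    (f : {scalar g})
    (f_comm : forall x y : g, f (x *_[A] y - y *_[A] x) = 0) :
  modified_RB_threeLie (bracketf_threeLie f_comm) lambda R <->
  forall x y z : g,
    R (f x *: (R y *_[A] R z - R z *_[A] R y)
       + f y *: (R z *_[A] R x - R x *_[A] R z)
       + f z *: (R x *_[A] R y - R y *_[A] R x)
       + (lambda * f x) *: (y *_[A] z - z *_[A] y)
       + (lambda * f y) *: (z *_[A] x - x *_[A] z)
       + (lambda * f z) *: (x *_[A] y - y *_[A] x))
    - (lambda * f x) *: (R y *_[A] z - z *_[A] R y)
    - (lambda * f x) *: (y *_[A] R z - R z *_[A] y)
    - (lambda * f y) *: (R z *_[A] x - x *_[A] R z)
    - (lambda * f y) *: (z *_[A] R x - R x *_[A] z)
    - (lambda * f z) *: (R x *_[A] y - y *_[A] R x)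
    - (lambda * f z) *: (x *_[A] R y - R y *_[A] x)
    - (2%:R * lambda * f (R y)) *: (z *_[A] x - x *_[A] z)
    - (2%:R * lambda * f (R x)) *: (y *_[A] z - z *_[A] y)
    - (2%:R * lambda * f (R z)) *: (x *_[A] y - y *_[A] x) = 0.
Proof.
have defect := @bracketf_RB_defect k g A lambda R RB_R f.
(* [defect] fits both goals up to conversion, by unfolding [lie_bracket] and the bracket of
   [bracketf_threeLie]. *)
split=> H x y z.
  apply: (etrans (defect x y z)); apply/eqP.
  by rewrite subr_eq0 eq_sym; apply/eqP/H.
apply/esym/eqP; rewrite -subr_eq0; apply/eqP.
exact: etrans (esym (defect x y z)) (H x y z).
Qed.
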